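(* Assume $\Delta=\sup_{x,y\in\mathbb R^k}|\ell(x)-\ell(y)|<\infty$ and let $\epsilon>0$. There is a constant $C$, depending on $\Delta,\epsilon,I_0$ but not on the threshold $b$, such that for any $b>0$ the DP-CUSUM stopping time $\tilde T(b)$ satisfies $$\mathbf E_0[\tilde T(b)]\le\frac{b}{I_0}+\frac{4\Delta}{I_0^{3/2}\epsilon}\sqrt b+C,$$ where $I_0=\mathbf E_0[\ell(X)]$ is the Kullback–Leibler divergence of the post-change density $f_1$ from the pre-change density $f_0$ (i.e. $I_0=\int f_1\log(f_1/f_0)$).
   Context: Let $f_0\ne f_1$ be two known distinct probability density functions on $\mathbb R^k$ (pre- and post-change densities) and let $\ell(x)=\log(f_1(x)/f_0(x))$ be the log-likelihood ratio. For a data sequence $X_1,X_2,\ldots\in\mathbb R^k$, the CUSUM statistics are $S_0=0$ and, for $t\ge1$, $$S_t=\max_{1\le k\le t}\sum_{j=k}^t\ell(X_j)=\max(0,S_{t-1})+\ell(X_t).$$ $\mathrm{Lap}(\beta)$ denotes the Laplace distribution with density $\exp(-|x|/\beta)/(2\beta)$, $\beta>0$. The DP-CUSUM procedure uses $\tilde S_t=S_t+Z_t$, where $Z_1,Z_2,\ldots$ are i.i.d. $\mathrm{Lap}(2\Delta/\epsilon)$, and a single $W\sim\mathrm{Lap}(2\Delta/\epsilon)$; $(Z_t)_{t\ge1}$, $W$ and the data are mutually independent. The stopping time with deterministic threshold $b$ is $$\tilde T(b)=\inf\{t>0:\tilde S_t\ge b+W\}.$$ $\mathbf E_0$ denotes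 expectation under the joint law in which $X_1,X_2,\ldots$ are i.i.d. with density $f_1$ (the change occurs at time $0$), together with the Laplace noises $(Z_t)$ and $W$ above. *)

(* Defs.v *)
From HB Require Import structures.
From mathcomp Require Import all_boot all_order all_algebra.
From mathcomp Require Import all_classical all_reals all_analysis.

Set Implicit Arguments.
Unset Strict Implicit.
Unset Printing Implicit Defensive.

Import Order.TTheory GRing.Theory Num.Theory.
Import numFieldNormedType.Exports.

Local Open Scope classical_set_scope.
Local Open Scope ring_scope.
Local Open Scope ereal_scope.

Section lebesgue_tuple.
Context (R : realType).
Local Notation Rm := (measurableTypeR R).

Definition tuple_consp (n : nat) (p : Rm * n.-tuple Rm) : n.+1.-tuple Rm :=
  [tuple of p.1 :: p.2].

Lemma measurable_tuple_consp n : measurable_fun [set: _] (@tuple_consp n).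
Proof.
apply: (@measurable_cons _ _ _ Rm fst n snd).
  exact: measurable_fst.
exact: measurable_snd.
Qed.

Section step.
Context (n : nat) (mu : {sigma_finite_measure set (n.-tuple Rm) -> \bar R}).

Definition lebesgue_tuple_step : set (n.+1.-tuple Rm) -> \bar R :=
  pushforward (@lebesgue_measure R \x mu) (@tuple_consp n).

Let step0 : lebesgue_tuple_step set0 = 0.
Proof. by rewrite /lebesgue_tuple_step /pushforward preimage_set0 measure0. Qed.

Let step_ge0 A : 0 <= lebesgue_tuple_step A.
Proof. exact: (measure_ge0 (product_measure1 _ _)). Qed.

Let step_sigma_additive : semi_sigma_additive lebesgue_tuple_step.
Proof.
move=> F mF tF mUF; rewrite /lebesgue_tuple_step /pushforward preimage_bigcup.
apply: measure_semi_sigma_additive.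
- by move=> n0; rewrite -[X in measurable X]setTI; exact: measurable_tuple_consp.
- apply/trivIsetP => /= i j _ _ ij; rewrite -preimage_setI.
  by move/trivIsetP : tF => /(_ _ _ _ _ ij) ->//; rewrite preimage_set0.
- rewrite -preimage_bigcup -[X in measurable X]setTI.
  exact: measurable_tuple_consp.
Qed.

HB.instance Definition _ := isMeasure.Build _ _ _ lebesgue_tuple_step
  step0 step_ge0 step_sigma_additive.

Lemma lebesgue_tuple_step_sigma_finite :
  sigma_finite [set: _] lebesgue_tuple_step.
Proof.
have /sigma_finiteP[F [TF ndF Foo]] := sigma_finiteT (@lebesgue_measure R).
have /sigma_finiteP[G [TG ndG Goo]] := sigma_finiteT mu.
pose h (x : n.+1.-tuple Rm) : Rm * n.-tuple Rm := (thead x, [tuple of behead x]).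
have mh : measurable_fun [set: _] h.
  apply/measurable_fun_pairP; split; first exact: measurable_tnth.
  exact: measurable_behead.
have hK p : h (tuple_consp p) = p.
  by case: p => a x; congr pair; exact: val_inj.
exists (fun i => h @^-1` (F i `*` G i)).
  rewrite -preimage_bigcup (_ : \bigcup_i _ = [set: _]) ?preimage_setT//.
  rewrite -setXTT TF TG predeqE => -[x y]; split.
    by move=> [i _ []/= ? ?]; split; exists i.
  move=> [/= [i _ Fix_] [j _ Gjy]]; exists (maxn i j) => //; split.
  - by move: x Fix_; exact/subsetPset/ndF/leq_maxl.
  - by move: y Gjy; exact/subsetPset/ndG/leq_maxr.
move=> i; have [mF Fi] := Foo i; have [mG Gi] := Goo i; split.
  by rewrite -[X in measurable X]setTI; apply: mh => //; exact: measurableX.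
rewrite /lebesgue_tuple_step /pushforward.
rewrite (_ : _ @^-1` _ = F i `*` G i); last first.
  by rewrite -comp_preimage (_ : h \o _ = id) ?preimage_id//; apply/funext.
by rewrite product_measure1E// lte_mul_pinfty// ge0_fin_numE.
Qed.

HB.instance Definition _ := @Measure_isSigmaFinite.Build _ _ _
  lebesgue_tuple_step lebesgue_tuple_step_sigma_finite.

End step.

(* Lebesgue measure on R^n, with R^n rendered as n.-tuple R carrying the product
   sigma-algebra. *)
Fixpoint lebesgue_tuple (n : nat) :
    {sigma_finite_measure set (n.-tuple Rm) -> \bar R} :=
  match n with
  | 0 => dirac [tuple]
  | m.+1 => lebesgue_tuple_step (lebesgue_tuple m)
  end.

Lemma lebesgue_tuple_box n (A : 'I_n -> set Rm) :
  (forall i, measurable (A i)) ->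
  lebesgue_tuple n [set x | forall i, A i (tnth x i)] =
  \prod_(i < n) lebesgue_measure (A i).
Proof.
elim: n A => [|n IHn] A mA.
  rewrite big_ord0 /= diracE mem_set//= => -[].
  by [].
rewrite big_ord_recl -(IHn (fun i => A (lift ord0 i)))//=.
rewrite /lebesgue_tuple_step /pushforward -product_measure1E//; last first.
  rewrite (_ : [set _ | _] = \bigcap_(i in [set: 'I_n])
    ((fun x : n.-tuple Rm => tnth x i) @^-1` A (lift ord0 i))); last first.
    apply/seteqP; split=> x /=; first by move=> h i _; exact: h.
    by move=> h i; exact: h.
  apply: fin_bigcap_measurable => // i _.
  by rewrite -[X in measurable X]setTI; exact: measurable_tnth.
congr (product_measure1 _ _ _).
apply/seteqP; split=> -[a x]; rewrite /preimage/= /tuple_consp/=.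
  move=> h; split=> [|i]; first by have := h ord0; rewrite tnth0.
  by have := h (lift ord0 i); rewrite tnthS.
move=> [ha hx] i; have [j ->|->] := unliftP ord0 i; first by rewrite tnthS.
by rewrite tnth0.
Qed.

End lebesgue_tuple.

Section densities.
Context (R : realType) (k : nat).
Implicit Types f : k.-tuple (measurableTypeR R) -> R.

Definition is_pdf f :=
  [/\ measurable_fun [set: _] f, forall x, (0 <= f x)%R &
      \int[lebesgue_tuple R k]_x (f x)%:E = 1].

(* log (f1 / f0), with log 0 = -oo and c / 0 = +oo for c > 0. At points where
   both densities vanish the ratio is undefined and the value is set to 0. This
   does not change [llr_osc]: where they do not both vanish, the log-ratio of two
   probability densities cannot be bounded away from 0 with a constant sign, so
   0 already lies between its infimum and its supremum there. When [llr_osc] is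
   finite, [llr] is finite everywhere. *)
Definition llr f0 f1 (x : k.-tuple (measurableTypeR R)) : \bar R :=
  if (f0 x == 0%R) && (f1 x == 0%R) then 0
  else lne ((f1 x)%:E / (f0 x)%:E).

Definition llr_osc f0 f1 : \bar R :=
  ereal_sup [set `|llr f0 f1 xy.1 - llr f0 f1 xy.2| | xy in [set: _]].

Definition kl_divergence f1 f0 : \bar R :=
  \int[lebesgue_tuple R k]_x ((f1 x)%:E * llr f0 f1 x).

End densities.

Section random_variables.
Context d (T : measurableType d) (R : realType) (P : probability T R).

Definition has_density d' (T' : measurableType d') (mu : {measure set T' -> \bar R})
    (X : {RV P >-> T'}) (f : T' -> R) :=
  forall A, measurable A -> distribution P X A = \int[mu]_(x in A) (f x)%:E.

Definition sigma_of d' (T' : measurableType d') (X : {RV P >-> T'}) :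
    set_system T :=
  preimage_set_system [set: T] X measurable.

Definition mutually_independent (I : eqType) (F : I -> set_system T) :=
  forall (s : seq I) (E : I -> set T), uniq s ->
    (forall i, i \in s -> F i (E i)) ->
    P (\bigcap_(i in [set` s]) E i) = \prod_(i <- s) P (E i).

Definition data_noise_sigma d' (T' : measurableType d')
    (X : nat -> {RV P >-> T'}) (Z : nat -> {RV P >-> measurableTypeR R})
    (W : {RV P >-> measurableTypeR R}) (i : nat + nat + unit) : set_system T :=
  match i with
  | inl (inl t) => sigma_of (X t)
  | inl (inr t) => sigma_of (Z t)
  | inr _ => sigma_of W
  end.

End random_variables.

Definition laplace_pdf (R : realType) (beta x : R) : R :=
  (expR (- (`|x| / beta)) / (2 * beta))%R.

Section cusum.
Context (R : realType).

(* [l t] is the log-likelihood ratio of the (t+1)-st observation. *)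
Fixpoint cusum (l : nat -> \bar R) (t : nat) : \bar R :=
  match t with
  | 0 => 0
  | t'.+1 => maxe 0 (cusum l t') + l t'
  end.

Lemma cusum_max l t :
  cusum l t.+1 =
  \big[maxe/-oo]_(0 <= j < t.+1) \sum_(j <= i < t.+1) l i.
Proof.
have DM (a b c : \bar R) : maxe a b + c = maxe (a + c) (b + c).
  have [ab|ba] := leP a b.
    by rewrite max_r// leeD2r.
  by rewrite max_l// leeD2r// ltW.
elim: t => [|t IHt].
  by rewrite /= maxxx add0e !big_nat1.
rewrite big_nat_recr//= big_nat1; move: IHt => /= ->.
rewrite DM add0e [LHS]maxC; congr maxe.
rewrite (big_morph (fun a => a + l t.+1) (fun a b => DM a b (l t.+1)) (addNye _)).
by apply: eq_big_nat => j /andP[_ jt]; rewrite [RHS]big_nat_recr//= ltnW.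
Qed.

(* The indices t range over t >= 1, written t.+1; [z t] is the noise added to
   the (t+1)-st CUSUM statistic. The value is +oo when the threshold is never
   crossed. *)
Definition dp_cusum_time (l : nat -> \bar R) (z : nat -> R) (w b : R) : \bar R :=
  ereal_inf [set (t.+1)%:R%:E | t in
    [set t | (b + w)%:E <= cusum l t.+1 + (z t)%:E]].

End cusum.

(* Main.v *)
Require Import Defs.
From HB Require Import structures.
From mathcomp Require Import all_boot all_order all_algebra.
From mathcomp Require Import all_classical all_reals all_analysis.
From mathcomp Require Import measurable_realfun.
From mathcomp Require Import ring lra.

Set Implicit Arguments.
Unset Strict Implicit.
Unset Printing Implicit Defensive.

Import Order.TTheory GRing.Theory Num.Theory.
Import numFieldNormedType.Exports.

Local Open Scope classical_set_scope.
Local Open Scope ring_scope.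

(** The proof compares the procedure with a plain random walk, to which Wald's
    identity applies. Write [l t] for the log-likelihood ratio of the [t]-th
    observation, [beta = 2 * Delta / eps] for the scale of the noises, and
    [I0 > 0] for the mean of [l t] (positivity is [kl_divergence_gt0]). The
    CUSUM statistic is at least the walk with steps [l t], so the stopping time
    is at most the first time at which this walk plus its noise reaches
    [b + W] ([dp_cusum_time_le]).

    Let [M] be the expectation of this crossing time, truncated at a level [N].
    Being still alive before the [t]-th observation is decided by [W] and by the
    earlier observations and noises, hence is independent of the [t]-th
    observation and noise ([alive_event_indep], a pi-lambda argument). So the
    walk at the truncated crossing time has expectation [I0 * M]. On the other
    hand, just before that time the walk was below [b + W - Z], and one step
    adds at most [I0 + Delta], because [l] oscillates by at most [Delta] around
    its mean.

    The only delicate term is the noise [Z] at the random time just before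
    crossing. For every [a > 0], [- Z] is at most [a + Z ^ 2 / (4 * a)], hence
    at most [a] plus the sum of [Z t ^ 2 / (4 * a)] over all times alive
    ([sum_alive_le]), whose expectation is at most [M * beta ^ 2 / a] by the
    bound [4 * beta ^ 2] on the second moment of the noise. Choosing
    [a = beta * sqrt M] gives
      [I0 * M <= b + (I0 + Delta + 2 * beta) + 2 * beta * sqrt M]
    ([sum_alive_event_le]); the term [2 * beta] bounds the mean of [`|W|].
    Solving this quadratic inequality ([le_of_sqrt_bound]) gives the leading
    term [b / I0], the coefficient [2 * beta / I0 ^ (3/2)] of [sqrt b] and a
    remainder free of [b] and [N]. Monotone convergence in [N] concludes. *)

(** * Moments of the Laplace distribution *)

Section laplace_moments.
Context (R : realType).
Local Notation leb := (@lebesgue_measure R).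

(** From [(1 + 1/16) ^ 16 <= e]. The value 13/5 is just large enough for
    [sqr_le_expR], which needs [27 <= 4 * e ^ 2]. *)
Lemma expR1_ge13_5 : 13 / 5 <= expR 1 :> R.
Proof.
have -> : 1 = 16%:R * 16^-1 :> R by rewrite mulfV.
rewrite expRM_natl.
have h : 17 / 16 <= expR 16^-1 :> R.
  by apply: le_trans (expR_ge1Dx _); lra.
have : (17 / 16) ^+ 16 <= expR 16^-1 ^+ 16 :> R.
  by apply: lerXn2r => //; rewrite nnegrE ?expR_ge0//; lra.
by apply: le_trans; lra.
Qed.

(** This is the tangent inequality [e * v <= exp v] at [v = u / 3], squared. It
    trades the factor [x ^ 2] in the second moment of a Laplace law of scale
    [beta] for a Laplace density of scale [3 * beta]. *)
Lemma sqr_le_expR (u : R) : 0 <= u -> 3 * u ^+ 2 <= 4 * expR (2 * (u / 3)).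
Proof.
move=> u0; rewrite expRM_natl.
have ev : 13 / 5 * (u / 3) <= expR (u / 3).
  have -> : u / 3 = 1 + (u / 3 - 1) by lra.
  rewrite expRD; apply: ler_pM; [lra | lra | exact: expR1_ge13_5 |].
  by have := expR_ge1Dx (u / 3 - 1); lra.
have : (13 / 5 * (u / 3)) ^+ 2 <= expR (u / 3) ^+ 2.
  by apply: lerXn2r => //; rewrite nnegrE ?expR_ge0//; lra.
have : 0 <= u ^+ 2 by rewrite sqr_ge0.
have -> : (13 / 5 * (u / 3)) ^+ 2 = 169 / 225 * u ^+ 2 by field.
by lra.
Qed.

Lemma laplace_pdf_ge0 (beta x : R) : 0 < beta -> 0 <= laplace_pdf beta x.
Proof. by move=> b0; rewrite divr_ge0 ?expR_ge0// mulr_ge0// ltW. Qed.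

Lemma continuous_laplace_pdf (beta : R) : continuous (laplace_pdf beta).
Proof.
move=> x; apply: cvgM; last exact: cvg_cst.
apply: continuous_comp; last exact: continuous_expR.
apply: cvgN; apply: cvgM; last exact: cvg_cst.
exact: norm_continuous.
Qed.

Lemma measurable_laplace_pdf (beta : R) :
  measurable_fun [set: measurableTypeR R] (laplace_pdf beta).
Proof. exact: continuous_measurable_fun (@continuous_laplace_pdf beta). Qed.

(** On each half-line the density is half an exponential density. *)
Lemma integral_laplace_pdf (beta : R) : 0 < beta ->
  (\int[leb]_x (laplace_pdf beta x)%:E = 1)%E.
Proof.
move=> b0; rewrite ge0_symfun_integralT.
- have -> : [set x : R | 0 <= x] = `[0, +oo[%classic.
    by apply/seteqP; split => x/=; rewrite in_itv/= andbT.
  rewrite -ge0_integralZl//; last 2 first.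
  + apply/measurable_EFinP/measurable_funTS.
    exact: measurable_laplace_pdf.
  + by move=> x _; rewrite lee_fin laplace_pdf_ge0.
  rewrite -(@integral_exponential_pdf R beta^-1) ?invr_gt0//.
  rewrite integral_mkcond; apply: eq_integral => x _.
  rewrite /patch; case: ifPn => [|nx].
    rewrite inE/= in_itv/= andbT => x0.
    rewrite exponential_pdfE// -EFinM /laplace_pdf ger0_norm//.
    congr (_%:E); rewrite mulNr [_^-1 * x]mulrC.
    by field; exact: lt0r_neq0.
  rewrite lt0_exponential_pdf//.
  by move: nx; rewrite notin_setE/= in_itv/= andbT => /negP; rewrite -ltNge.
- by move=> x; exact: laplace_pdf_ge0.
- exact: continuous_laplace_pdf.
- by move=> x; rewrite /laplace_pdf/= normrN.
Qed.

(** The exact value is [2 * beta ^ 2]; the bound [4 * beta ^ 2] is the largest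
    one that gives the coefficient of [sqrt b] in the theorem, and it follows
    from a pointwise comparison with the density of scale [3 * beta]. *)
Lemma laplace_second_moment (beta : R) : 0 < beta ->
  (\int[leb]_x ((x ^+ 2)%:E * (laplace_pdf beta x)%:E) <= (4 * beta ^+ 2)%:E)%E.
Proof.
move=> b0; have b30 : 0 < 3 * beta by rewrite mulr_gt0.
have mlap c : measurable_fun [set: measurableTypeR R] (EFin \o laplace_pdf c).
  by apply/measurable_EFinP; exact: measurable_laplace_pdf.
rewrite -[leRHS]mule1 -(integral_laplace_pdf b30) -ge0_integralZl//; last 3 first.
- exact: mlap.
- by move=> x _; rewrite lee_fin laplace_pdf_ge0.
- by rewrite lee_fin mulr_ge0// sqr_ge0.
apply: ge0_le_integral => //.
- by move=> x _; rewrite -EFinM lee_fin mulr_ge0 ?sqr_ge0 ?laplace_pdf_ge0.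
- apply: emeasurable_funM; last exact: mlap.
  by apply/measurable_EFinP; exact: measurable_funX.
- by apply: emeasurable_funM => //; exact: mlap.
move=> x _; rewrite -!EFinM lee_fin /laplace_pdf.
set u := `|x| / beta.
have xu : x ^+ 2 = beta ^+ 2 * u ^+ 2.
  rewrite /u expr_div_n mulrCA mulfV ?mulr1 ?real_normK ?num_real//.
  by rewrite gt_eqF// exprn_gt0.
have -> : `|x| / (3 * beta) = u / 3 by rewrite /u invfM; lra.
have := @sqr_le_expR u (divr_ge0 (normr_ge0 _) (ltW b0)).
have -> : 2 * (u / 3) = u + - (u / 3) by lra.
rewrite expRD => h.
have h' : 3 * (u ^+ 2 * expR (- u)) <= 4 * expR (- (u / 3)).
  have ee : expR u * expR (- u) = 1 by rewrite -expRD subrr expR0.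
  have := ler_wpM2r (ltW (expR_gt0 (- u))) h.
  by rewrite -!mulrA [_ * expR (- u)]mulrC [expR u * _]mulrCA mulrA ee mulr1.
rewrite xu -subr_ge0.
move: h'; rewrite -subr_ge0 => h'.
have -> : 4 * beta ^+ 2 * (expR (- (u / 3)) / (2 * (3 * beta))) -
    beta ^+ 2 * u ^+ 2 * (expR (- u) / (2 * beta)) =
    beta / 6 * (4 * expR (- (u / 3)) - 3 * (u ^+ 2 * expR (- u))).
  by field; exact: lt0r_neq0.
by rewrite mulr_ge0// divr_ge0// ltW.
Qed.

End laplace_moments.

(** At scale 0 the formula for the density is identically 0, by [/ 0 = 0]. *)
Lemma laplace_density_gt0 (R : realType) d (T : measurableType d)
    (P : probability T R) (V : {RV P >-> measurableTypeR R}) (beta : R) :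
  has_density (@lebesgue_measure R) V (laplace_pdf beta) ->
  0 <= beta -> 0 < beta.
Proof.
move=> Vf; rewrite le_eqVlt => /predU1P[b0|//].
have := Vf _ measurableT; rewrite probability_setT integral0_eq.
  by move=> /eqP; rewrite onee_eq0.
by move=> x _; rewrite /laplace_pdf -b0 mulr0 invr0 mulr0.
Qed.

(** * Integrals of nonnegative random variables *)

(** Monotonicity without measurability, for the stopping time: the integral of
    a nonnegative function is a supremum over simple functions below it. *)
Lemma ge0_le_integralT d (T : measurableType d) (R : realType)
    (mu : {measure set T -> \bar R}) (f g : T -> \bar R) :
  (forall x, (0 <= f x)%E) -> (forall x, (f x <= g x)%E) ->
  (\int[mu]_x f x <= \int[mu]_x g x)%E.
Proof.
move=> f0 fg; rewrite !ge0_integralTE//; last first.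
  by move=> x; exact: le_trans (fg x).
apply: ereal_sup_le; apply: image_subset => h hf x.
exact: le_trans (hf x) (fg x).
Qed.

Section independence.
Context d (T : measurableType d) (R : realType) (P : probability T R).
Local Open Scope ereal_scope.

(** A density that represents the law of [X] agrees almost everywhere with its
    Radon-Nikodym derivative, which has this change of variables. *)
Lemma ge0_integral_density d' (T' : measurableType d')
    (mu : {sigma_finite_measure set T' -> \bar R}) (X : {RV P >-> T'})
    (f : T' -> R) (g : T' -> \bar R) :
  measurable_fun [set: T'] f -> has_density mu X f ->
  measurable_fun [set: T'] g -> (forall x, 0 <= g x) ->
  \int[P]_w g (X w) = \int[mu]_x (g x * (f x)%:E).
Proof.
move=> mf Xf mg g0; rewrite -(ge0_integral_distribution X mg g0).
pose nu : {finite_measure set T' -> \bar R} := distribution P X.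
have numu : nu `<< mu.
  apply/null_content_dominatesP => A mA A0.
  rewrite /nu/= Xf// null_set_integral//.
  by apply/measurable_EFinP; exact: measurable_funTS.
rewrite -(Radon_Nikodym_SigmaFinite.change_of_variables numu g0)//.
apply: ae_eq_integral => //.
- apply: emeasurable_funM => //; apply: measurable_int.
  exact: Radon_Nikodym_SigmaFinite.f_integrable.
- by apply: emeasurable_funM => //; exact/measurable_EFinP.
apply: ae_eqe_mul2l; apply: integral_ae_eq => //.
- exact: Radon_Nikodym_SigmaFinite.f_integrable.
- exact/measurable_EFinP.
move=> A _ mA; rewrite -Radon_Nikodym_SigmaFinite.f_integral//.
exact: Xf.
Qed.

(** Independence from [X] says that the image under [X] of the restriction of
    [P] to [A] is [P A] times the law of [X]; integrate [g] against both. *)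
Lemma ge0_integral_indep d' (T' : measurableType d') (X : {RV P >-> T'})
    (A : set T) (g : T' -> \bar R) : measurable A ->
  (forall B, sigma_of X B -> P (A `&` B) = P A * P B) ->
  measurable_fun [set: T'] g -> (forall x, 0 <= g x) ->
  \int[P]_w ((\1_A w)%:E * g (X w)) = P A * \int[P]_w g (X w).
Proof.
move=> mA iA mg g0.
have mgX : measurable_fun [set: T] (g \o X) by exact: measurableT_comp.
have -> : \int[P]_w ((\1_A w)%:E * g (X w)) = \int[P]_(w in A) (g \o X) w.
  rewrite [RHS]integral_mkcond; apply: eq_integral => w _.
  by rewrite epatch_indic muleC.
have pA : P A = (fine (P A))%:E by rewrite fineK// fin_num_measure.
have pA0 : (0 <= fine (P A))%R by rewrite fine_ge0.
transitivity (\int[mrestr P mA]_w (g (X w))).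
  rewrite [RHS](@ge0_negligible_integral _ _ _ _ _ (~` A))//; last 2 first.
  - exact: measurableC.
  - by rewrite /= /mrestr setIC setICr measure0.
  rewrite setTD setCK; apply: eq_measure_integral => B mB BA.
  by rewrite /= /mrestr setIidl.
transitivity (\int[pushforward (mrestr P mA) X]_y g y).
  by rewrite ge0_integral_pushforward.
rewrite pA -(ge0_integral_distribution X mg g0).
rewrite -(@ge0_integral_mscale _ _ _ _ _ _ (NngNum pA0))//.
apply: eq_measure_integral => B mB _.
rewrite /= /mscale/= /pushforward/= /mrestr/= -pA setIC iA//.
by exists B; rewrite ?setTI.
Qed.

End independence.

(** * Independence from a generated sigma-algebra *)

Section cylinders.
Context d (T : measurableType d) (R : realType) (P : probability T R).
Context (I : choiceType) (F : I -> set_system T).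
Local Open Scope ereal_scope.

(** A pi-system that generates the sigma-algebra of the family [F] over [s]. *)
Definition cylinders (s : seq I) : set_system T :=
  [set A | exists2 E, (forall i, i \in s -> F i (E i)) &
                      A = \bigcap_(i in [set` s]) E i].

Hypothesis FT : forall i, F i [set: T].

Lemma cylinders_single (s : seq I) i B : i \in s -> F i B -> cylinders s B.
Proof.
move=> si FB; exists (fun k => if k == i then B else [set: T]).
  by move=> k _; case: eqP => [->|_].
apply/seteqP; split => [w Bw k _|w /(_ i)]; first by case: ifP.
by rewrite eqxx; apply; rewrite /= si.
Qed.

Lemma measurable_fun_cylinders d' (T' : measurableType d') (X : T -> T')
    (s : seq I) i : i \in s ->
  (forall B, measurable B -> F i (X @^-1` B)) ->
  measurable_fun [set: g_sigma_algebraType (cylinders s)]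
    (X : g_sigma_algebraType (cylinders s) -> T').
Proof.
move=> si FX _ B mB; rewrite setTI; apply: sub_sigma_algebra.
by apply: cylinders_single si _; exact: FX.
Qed.

Hypothesis FI : forall i, setI_closed (F i).
Hypothesis Fm : forall i, F i `<=` measurable.
Hypothesis Findep : mutually_independent P F.

(** Product rules only speak of cylinders. As both sides are finite measures in
    [A] and cylinders are stable under intersection, the rule extends to the
    sigma-algebra which they generate. *)
Lemma mutually_independent_cylinders (s : seq I) j A B :
    uniq s -> j \notin s -> <<s cylinders s >> A -> F j B ->
  P (A `&` B) = P A * P B.
Proof.
move=> us js sA FB; have mB := Fm FB.
have pB : P B = (fine (P B))%:E by rewrite fineK// fin_num_measure.
have pB0 : (0 <= fine (P B))%R by rewrite fine_ge0.
pose m1 : {measure set T -> \bar R} := mrestr P mB.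
pose m2 : {measure set T -> \bar R} := mscale (NngNum pB0) P.
have m2E C : m2 C = P C * P B.
  by rewrite /m2 /= /mscale/= -pB muleC.
rewrite -m2E; suff : m1 A = m2 A by [].
move: A sA; apply: (@g_sigma_algebra_measure_unique _ _ _ _ _ (fun=> setT)).
- move=> _ [E FE ->]; apply: fin_bigcap_measurable => //.
  by move=> i si; apply/Fm/FE.
- move=> _; exists (fun=> setT); first by move=> i _; exact: FT.
  by apply/seteqP; split.
- by rewrite bigcup_const//; exists 0%N.
- move=> _ _ [E FE ->] [E' FE' ->]; exists (fun i => E i `&` E' i).
    by move=> i si; apply: FI; [exact: FE|exact: FE'].
  by rewrite bigcapI.
- move=> _ [E FE ->]; rewrite m2E (Findep us FE).
  pose E' i := if i == j then B else E i.
  have sE' i : i \in s -> E' i = E i.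
    by rewrite /E'; case: eqP => // -> jins; rewrite jins in js.
  have E'j : E' j = B by rewrite /E' eqxx.
  have /Findep/(_ _) : uniq (j :: s) by rewrite /= js.
  move=> /(_ E'); rewrite big_cons.
  rewrite (eq_big_seq (fun i => P (E i))); last by move=> i /sE' ->.
  rewrite E'j [RHS]muleC => <-; last first.
    move=> i; rewrite inE /E'; case: eqP => [->|_]//=; exact: FE.
  rewrite /m1/= /mrestr; congr (P _); apply/seteqP; split => w.
    move=> [Ew Bw] i /=; rewrite inE /E'; case: eqP => //= _ si.
    exact: Ew.
  move=> Ew; split; last first.
    by have := Ew j; rewrite /E' eqxx; apply; rewrite /= mem_head.
  by move=> i si; rewrite -(sE' _ si); apply: Ew; rewrite /= inE si orbT.
- move=> _; rewrite /m1 /= /mrestr setTI.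
  by rewrite (le_lt_trans (probability_le1 _ _))// ltry.
Qed.

End cylinders.

(** * The log-likelihood ratio *)

Section log_likelihood_ratio.
Context (R : realType) (k : nat).
Context (f0 f1 : k.-tuple (measurableTypeR R) -> R).
Hypotheses (pdf0 : is_pdf f0) (pdf1 : is_pdf f1).
Hypothesis osc : (llr_osc f0 f1 < +oo)%E.

Local Notation mu := (lebesgue_tuple R k).
Local Notation l x := (fine (llr f0 f1 x)).
Local Notation Delta := (fine (llr_osc f0 f1)).
Local Notation I0 := (fine (kl_divergence f1 f0)).

Let mf0 : measurable_fun [set: _] f0. Proof. by case: pdf0. Qed.
Let mf1 : measurable_fun [set: _] f1. Proof. by case: pdf1. Qed.
Let f0_ge0 x : 0 <= f0 x. Proof. by case: pdf0. Qed.
Let f1_ge0 x : 0 <= f1 x. Proof. by case: pdf1. Qed.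

Lemma llr_osc_ub x y : (`|llr f0 f1 x - llr f0 f1 y| <= llr_osc f0 f1)%E.
Proof. by apply: ereal_sup_ubound; exists (x, y). Qed.

(** An infinite value at [x] would make already [`|llr x - llr x|] infinite. *)
Lemma llr_fin_num x : llr f0 f1 x \is a fin_num.
Proof.
have := le_lt_trans (llr_osc_ub x x) osc.
by case: (llr f0 f1 x).
Qed.

Lemma llr_EFin x : llr f0 f1 x = (l x)%:E.
Proof. by rewrite fineK// llr_fin_num. Qed.

Lemma llr_osc_fin_num : llr_osc f0 f1 \is a fin_num.
Proof.
rewrite ge0_fin_numE//.
have x : k.-tuple (measurableTypeR R) := [tuple 0 | _ < k].
exact: le_trans (abse_ge0 _) (llr_osc_ub x x).
Qed.

Lemma llr_osc_ge0 : 0 <= Delta.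
Proof.
have x : k.-tuple (measurableTypeR R) := [tuple 0 | _ < k].
by apply: fine_ge0; exact: le_trans (abse_ge0 _) (llr_osc_ub x x).
Qed.

Lemma llr_dist x y : `|l x - l y| <= Delta.
Proof.
have := llr_osc_ub x y.
rewrite [llr _ _ x]llr_EFin [llr _ _ y]llr_EFin -(fineK llr_osc_fin_num).
by rewrite -EFinB abse_EFin lee_fin.
Qed.

(** Finiteness of the log-ratio forces the two densities to vanish together. *)
Lemma llr_spec x : (f0 x = 0 /\ f1 x = 0) \/ (0 < f0 x /\ 0 < f1 x).
Proof.
have := llr_fin_num x; rewrite /llr.
have [f00|f00] := eqVneq (f0 x) 0; have [f10|f10] := eqVneq (f1 x) 0 => /=.
- by left.
- have f1p : 0 < f1 x by rewrite lt0r f10 f1_ge0.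
  by rewrite f00 inve0 gt0_muley// lte_fin.
- rewrite f10 mul0e /= lexx; by [].
- by right; rewrite !lt0r f00 f10 f0_ge0 f1_ge0.
Qed.

(** With [ln 0 = 0] this holds also where both densities vanish, which makes
    measurability immediate. *)
Lemma llrE x : l x = ln (f1 x) - ln (f0 x).
Proof.
rewrite /llr; have [[-> ->]|[p0 p1]] := llr_spec x.
  by rewrite eqxx/= subrr.
rewrite (gt_eqF p0)/= inver (gt_eqF p0) -EFinM lne_EFin ?divr_gt0//=.
by rewrite ln_div.
Qed.

Lemma density_ratio x : f0 x = f1 x * expR (- l x).
Proof.
rewrite llrE; have [[-> ->]|[p0 p1]] := llr_spec x; first by rewrite mul0r.
by rewrite opprB expRD expRN !lnK ?posrE// mulrCA divff ?mulr1// gt_eqF.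
Qed.

Lemma measurable_llr : measurable_fun [set: _] (fun x => l x).
Proof.
under eq_fun do rewrite llrE.
by apply: measurable_funB; apply: measurableT_comp => //; exact: measurable_ln.
Qed.

Lemma integrable_pdf (f : k.-tuple (measurableTypeR R) -> R) : is_pdf f ->
  mu.-integrable [set: _] (EFin \o f).
Proof.
move=> [mf fge0 intf]; apply/integrableP; split; first exact/measurable_EFinP.
under eq_integral do rewrite /= ger0_norm//.
by rewrite intf ltry.
Qed.

Lemma integrable_f1_bounded (g : k.-tuple (measurableTypeR R) -> R) (B : R) :
  measurable_fun [set: _] g -> (forall x, `|g x| <= B) ->
  mu.-integrable [set: _] (fun x => (f1 x * g x)%:E).
Proof.
move=> mg gB.
apply: (@le_integrable _ _ _ mu setT _ _ (fun x => B%:E * (f1 x)%:E)%E) => //.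
- by apply/measurable_EFinP; exact: measurable_funM.
- move=> x _; rewrite -EFinM !abse_EFin lee_fin !normrM [leLHS]mulrC.
  rewrite ler_wpM2r//; apply: le_trans (gB x) (ler_norm _).
by apply: integrableZl => //; exact: integrable_pdf.
Qed.

Let x0 : k.-tuple (measurableTypeR R) := [tuple 0 | _ < k].

Lemma llr_bounded : exists B : R, forall x, `|l x| <= B.
Proof.
exists (`|l x0| + Delta) => x.
rewrite -[fine (llr f0 f1 x)](subrK (l x0)) addrC.
rewrite (le_trans (ler_normD _ _))// lerD2l.
exact: llr_dist.
Qed.

Lemma integrable_f1_llr : mu.-integrable [set: _] (fun x => (f1 x * l x)%:E).
Proof.
have [B lB] := llr_bounded.
exact: integrable_f1_bounded measurable_llr lB.
Qed.

Lemma integral_f1_llr : (\int[mu]_x (f1 x * l x)%:E = I0%:E)%E.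
Proof.
have <- : (kl_divergence f1 f0 = \int[mu]_x (f1 x * l x)%:E)%E.
  by rewrite /kl_divergence; under eq_integral do rewrite llr_EFin -EFinM.
rewrite fineK//.
have -> : (kl_divergence f1 f0 = \int[mu]_x (f1 x * l x)%:E)%E.
  by rewrite /kl_divergence; under eq_integral do rewrite llr_EFin -EFinM.
exact: integrable_fin_num integrable_f1_llr.
Qed.

(** Shifting by a bound [B] of the log-ratio makes the integrand nonnegative, so
    that expectations of random sums need no integrability argument. *)
Lemma integral_f1_llr_shift (B : R) :
  (\int[mu]_x ((l x + B)%:E * (f1 x)%:E) = (I0 + B)%:E)%E.
Proof.
rewrite EFinD -integral_f1_llr.
have [_ _ int1] := pdf1.
have -> : (B%:E = \int[mu]_x (B%:E * (f1 x)%:E))%E.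
  by rewrite integralZl ?int1 ?mule1//; exact: integrable_pdf.
rewrite -integralD//.
- by apply: eq_integral => x _; rewrite -!EFinM -EFinD mulrDl [f1 x * _]mulrC.
- exact: integrable_f1_llr.
- by apply: integrableZl => //; exact: integrable_pdf.
Qed.

(** [Delta - (l x - l y)] is nonnegative; average it over [y] under [f1]. *)
Lemma llr_le_mean x : l x <= I0 + Delta.
Proof.
have : (0 <= \int[mu]_y ((l y + (Delta - l x))%:E * (f1 y)%:E))%E.
  apply: integral_ge0 => y _; rewrite -EFinM lee_fin mulr_ge0//.
  by have := llr_dist x y; rewrite ler_norml => /andP[_]; lra.
by rewrite integral_f1_llr_shift lee_fin; lra.
Qed.

(** Since [f1 - f0 = f1 * (1 - exp (- l))] has integral 0, the divergence is the
    integral of [f1 * (l - 1 + exp (- l))]. The second factor is nonnegative and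
    vanishes only for [l = 0], where the densities agree, and they also agree
    where [f1 = 0]. *)
Lemma kl_divergence_gt0 : ~ {ae mu, forall x, f0 x = f1 x} -> 0 < I0.
Proof.
move=> f01; pose h x := f1 x * (l x - 1 + expR (- l x)).
have hE x : h x = f1 x * l x - (f1 x - f0 x).
  by rewrite /h [in RHS]density_ratio; ring.
have h0 x : 0 <= h x.
  by rewrite mulr_ge0//; have := expR_ge1Dx (- l x); lra.
have mh : measurable_fun [set: _] (EFin \o h).
  apply/measurable_EFinP/measurable_funM => //.
  have ml := measurable_llr.
  apply: measurable_funD; first exact: measurable_funB.
  by apply: measurableT_comp => //; exact: measurableT_comp.
have inth : (\int[mu]_x (h x)%:E = I0%:E)%E.
  have [_ _ int1] := pdf1; have [_ _ int0] := pdf0.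
  have i10 :=
    integrableB measurableT (integrable_pdf pdf1) (integrable_pdf pdf0).
  under eq_integral do rewrite hE !EFinB.
  rewrite (integralB _ integrable_f1_llr i10)// integral_f1_llr.
  rewrite integralB//; [|exact: integrable_pdf..].
  by rewrite int1 int0 subee// sube0.
rewrite lt0r -lee_fin -inth integral_ge0 ?andbT; last first.
  by move=> x _; rewrite lee_fin.
apply/eqP => I00; apply: f01.
have : (\int[mu]_x `|(EFin \o h) x| = 0)%E.
  by under eq_integral do rewrite /= ger0_norm//; rewrite inth I00.
move=> /(ae_eq_integral_abs mu measurableT mh); apply: filterS.
move=> x /(_ I) /= [] /eqP; rewrite mulf_eq0 => /orP[/eqP f10|/eqP l0].
  by rewrite density_ratio f10 mul0r.
suff lx0 : l x = 0 by rewrite density_ratio lx0 oppr0 expR0 mulr1.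
apply/eqP/negPn/negP => lx0.
have : - l x != 0 by rewrite oppr_eq0.
by move=> /expR_gt1Dx; lra.
Qed.

End log_likelihood_ratio.

(** * First passage along a path *)

Section first_passage.
Context (R : realType).
Implicit Types (l z : nat -> R) (w b : R).

(** The crossing test with the CUSUM statistic replaced by the random walk that
    it dominates: [alive n] says that no crossing occurred among the first [n]
    observations, so it depends only on these, their noises and [w]. *)
Definition crossed l z w b (n : nat) : bool :=
  b + w <= \sum_(i < n.+1) l i + z n.

Fixpoint alive l z w b (n : nat) : bool :=
  if n is m.+1 then alive l z w b m && ~~ crossed l z w b m else true.

Lemma aliveS l z w b n :
  alive l z w b n.+1 = alive l z w b n && ~~ crossed l z w b n.
Proof. by []. Qed.

Lemma sum_le_cusum l n :
  ((\sum_(i < n) l i)%:E <= cusum (fun i => (l i)%:E) n)%E.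
Proof.
elim: n => [|n IHn] /=; first by rewrite big_ord0.
by rewrite big_ord_recr/= EFinD leeD2r// le_max IHn orbT.
Qed.

(** The right-hand side is the first crossing time of the random walk, written
    as the number of times at which it is still alive. *)
Lemma dp_cusum_time_le l z w b :
  (dp_cusum_time (fun i => (l i)%:E) z w b <=
   \sum_(0 <= n <oo) (alive l z w b n)%:R%:E)%E.
Proof.
set S := (X in (_ <= X)%E).
have sumS n : (\sum_(0 <= i < n) (alive l z w b i)%:R%:E <= S)%E.
  by apply: nneseries_lim_ge => i _ _; rewrite lee_fin.
have aliveE n : (forall i, (i < n)%N -> ~~ crossed l z w b i) ->
    (\sum_(0 <= i < n.+1) (alive l z w b i)%:R%:E = n.+1%:R%:E :> \bar R)%E.
  move=> nc; rewrite sumEFin (eq_big_nat _ _ (F2 := fun=> 1)); last first.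
    move=> i /andP[_]; rewrite ltnS => le_in.
    suff -> : alive l z w b i by [].
    elim: i le_in => //= i IHi lt_in.
    by rewrite IHi ?(ltnW lt_in)// nc.
  by rewrite big_const_nat iter_addr addr0 subn0.
have [[n cn]|nc] := pselect (exists n, crossed l z w b n); last first.
  suff -> : S = +oo%E by rewrite leey.
  apply/eqyP => A A0.
  have [n An] : exists n : nat, A <= n.+1%:R.
    by exists (Num.truncn A); apply: ltW; exact: truncnS_gt.
  apply: le_trans (sumS n.+1); rewrite aliveE ?lee_fin// => i _.
  by apply/negP => ci; apply: nc; exists i.
have [m cm mmin] := ex_minnP (ex_intro _ n cn).
apply: le_trans (sumS m.+1); rewrite aliveE; last first.
  by move=> i im; apply/negP => /mmin; rewrite leqNgt im.
apply: ereal_inf_lbound; exists m => //=.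
have := sum_le_cusum l m.+1; move: cm; rewrite /crossed -lee_fin EFinD.
by move=> /le_trans h /= hc; apply: h; rewrite EFinD leeD2r.
Qed.

Lemma opp_le_sqr (a y : R) : 0 < a -> - y <= a + y ^+ 2 / (4 * a).
Proof.
move=> a0; rewrite -subr_ge0.
have -> : a + y ^+ 2 / (4 * a) - - y = (y + 2 * a) ^+ 2 / (4 * a).
  by field; exact: lt0r_neq0.
by rewrite divr_ge0 ?sqr_ge0// mulr_ge0// ltW.
Qed.

(** The left-hand side is the walk stopped at the crossing time or at [N]. One
    step earlier at time [t], when the walk was still alive, it was below
    [b + w - z t]; the last step adds at most [L]. The noise [z t] is read off
    at a random time, so its law there is unknown. It is therefore replaced by
    the sum of all squared noises seen while alive, each of which is independent
    of being alive. The parameter [a] is free, to be optimized after taking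
    expectations. *)
Lemma sum_alive_le l z w b (L a : R) (N : nat) :
  0 < a -> 0 <= L -> 0 <= b -> (forall t, l t <= L) ->
  \sum_(t < N) (alive l z w b t)%:R * l t <=
  L + b + `|w| + a + \sum_(t < N) (alive l z w b t)%:R * (z t ^+ 2 / (4 * a)).
Proof.
move=> a0 L0 b0 lL.
have q0 t : 0 <= (alive l z w b t)%:R * (z t ^+ 2 / (4 * a)).
  by rewrite mulr_ge0// divr_ge0 ?sqr_ge0// mulr_ge0// ltW.
have sum_alive t : alive l z w b t ->
    \sum_(i < t) (alive l z w b i)%:R * l i = \sum_(i < t) l i.
  elim: t => [|t IHt]; first by rewrite !big_ord0.
  rewrite aliveS => /andP[at_ _]; by rewrite !big_ord_recr/= IHt// at_ mul1r.
elim: N => [|N IHN].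
  by rewrite !big_ord0 addr0 !addr_ge0// ltW.
have [aN|aN] := boolP (alive l z w b N); last first.
  by rewrite !big_ord_recr/= (negbTE aN) !mul0r !addr0.
rewrite big_ord_recr/= sum_alive// aN mul1r.
case: N aN {IHN} => [|N].
  move=> _; rewrite big_ord0 add0r big_ord1.
  have := q0 0%N; have := lL 0%N; have := normr_ge0 w; lra.
rewrite aliveS => /andP[aN ncN].
have cN : \sum_(i < N.+1) l i + z N < b + w by rewrite ltNge.
rewrite [in leRHS]big_ord_recr/= [in leRHS]big_ord_recr/=.
have s0 : 0 <= \sum_(i < N) (alive l z w b i)%:R * (z i ^+ 2 / (4 * a)).
  by apply: sumr_ge0 => i _; exact: q0.
have := q0 N.+1; rewrite [alive _ _ _ _ N.+1]aliveS aN ncN => qN.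
have := opp_le_sqr (z N) a0; have := lL N.+1; have := ler_norm w.
rewrite !mul1r in qN *; lra.
Qed.

End first_passage.

Section measurable_alive.
Context d (T : measurableType d) (R : realType).

Lemma measurable_alive (l z : nat -> T -> R) (w : T -> R) (b : R) (n : nat) :
  (forall i, (i < n)%N -> measurable_fun [set: T] (l i)) ->
  (forall i, (i < n)%N -> measurable_fun [set: T] (z i)) ->
  measurable_fun [set: T] w ->
  measurable [set x | alive (l^~ x) (z^~ x) (w x) b n].
Proof.
elim: n => [|n IHn] ml mz mw.
  by rewrite (_ : [set _ | _] = setT)//; apply/seteqP; split.
have -> : [set x | alive (l^~ x) (z^~ x) (w x) b n.+1] =
    [set x | alive (l^~ x) (z^~ x) (w x) b n] `\`
    [set x | b + w x <= \sum_(i < n.+1) l i x + z n x].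
  by apply/seteqP; split => x /=; [move=> /andP[? /negP]|move=> [-> /negP]].
apply: measurableD; first by apply: IHn => // i /ltnW; [exact: ml|exact: mz].
rewrite -[X in measurable X]setTI; apply: measurable_fun_le => //.
  exact: measurable_funD.
apply: measurable_funD; last exact: mz.
by apply: measurable_sum => i; exact: ml.
Qed.

End measurable_alive.

(** * Expected first passage time *)

Section expected_passage.
Context (R : realType) (k : nat) (f0 f1 : k.-tuple (measurableTypeR R) -> R).
Hypotheses (pdf0 : is_pdf f0) (pdf1 : is_pdf f1).
Hypothesis osc : (llr_osc f0 f1 < +oo)%E.
Context d (Omega : measurableType d) (P : probability Omega R).
Context (X : nat -> {RV P >-> k.-tuple (measurableTypeR R)}).
Context (Z : nat -> {RV P >-> measurableTypeR R}).
Context (W : {RV P >-> measurableTypeR R}) (beta b : R).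
Hypotheses (beta_gt0 : 0 < beta) (b_ge0 : 0 <= b).
Hypothesis Xf : forall t, has_density (lebesgue_tuple R k) (X t) f1.
Hypothesis Zf :
  forall t, has_density (@lebesgue_measure R) (Z t) (laplace_pdf beta).
Hypothesis Wf : has_density (@lebesgue_measure R) W (laplace_pdf beta).
Hypothesis XZW : mutually_independent P (data_noise_sigma X Z W).

Let l t w := fine (llr f0 f1 (X t w)).
Local Notation Delta := (fine (llr_osc f0 f1)).
Local Notation I0 := (fine (kl_divergence f1 f0)).
Local Notation F := (data_noise_sigma X Z W).

Definition alive_event (n : nat) : set Omega :=
  [set w | alive (l^~ w) (Z^~ w) (W w) b n].

(** Indices, in the independent family, of what determines [alive_event n]: the
    threshold noise and the first [n] observations and noises. *)
Definition past (n : nat) : seq (nat + nat + unit) :=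
  inr tt ::
    [seq inl (inl i) | i <- iota 0 n] ++ [seq inl (inr i) | i <- iota 0 n].

Lemma uniq_past n : uniq (past n).
Proof.
rewrite /= mem_cat negb_or cat_uniq !map_inj_uniq ?iota_uniq//=; last 2 first.
- by move=> i j [].
- by move=> i j [].
rewrite andbT -andbA; apply/and3P; split.
- by apply/mapP => -[].
- by apply/mapP => -[].
- by apply/hasPn => _ /mapP[i _ ->]; apply/mapP => -[].
Qed.

Lemma past_data i n : (inl (inl i) \in past n) = (i < n)%N.
Proof.
rewrite inE/= mem_cat mem_map; last by move=> ? ? [].
rewrite mem_iota add0n/= orbC; case: mapP => [[]|]//.
Qed.

Lemma past_noise i n : (inl (inr i) \in past n) = (i < n)%N.
Proof.
rewrite inE/= mem_cat orbC mem_map; last by move=> ? ? [].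
by rewrite mem_iota add0n/=; case: mapP => [[]|]//=; rewrite orbF.
Qed.

Let measurable_RV (V : {RV P >-> measurableTypeR R}) :
  measurable_fun [set: Omega] (fun w => V w : R).
Proof. exact: (@measurable_funPT _ _ _ (measurableTypeR R) V). Qed.

Let measurable_RV_sqr (V : {RV P >-> measurableTypeR R}) :
  measurable_fun [set: Omega] (fun w => V w ^+ 2 : R).
Proof. exact: measurable_funX (measurable_RV V). Qed.

Lemma sigma_of_preimage d' (T' : measurableType d') (Y : {RV P >-> T'}) B :
  measurable B -> sigma_of Y (Y @^-1` B).
Proof. by move=> mB; exists B => //; rewrite setTI. Qed.

Lemma sigma_ofT d' (T' : measurableType d') (Y : {RV P >-> T'}) :
  sigma_of Y [set: Omega].
Proof. by exists setT => //; rewrite setTI preimage_setT. Qed.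

Lemma sigma_ofI d' (T' : measurableType d') (Y : {RV P >-> T'}) :
  setI_closed (sigma_of Y).
Proof.
move=> _ _ [A mA <-] [B mB <-]; exists (A `&` B); first exact: measurableI.
by rewrite !setTI preimage_setI.
Qed.

Lemma sigma_of_measurable d' (T' : measurableType d') (Y : {RV P >-> T'}) :
  sigma_of Y `<=` measurable.
Proof. by move=> _ [B mB <-]; apply: measurable_funP. Qed.

Lemma alive_event_past n : <<s cylinders F (past n) >> (alive_event n).
Proof.
have FT i : F i [set: Omega] by case: i => [[]|] *; exact: sigma_ofT.
apply: (@measurable_alive _ (g_sigma_algebraType (cylinders F (past n)))).
- move=> i lt_in; apply: (measurableT_comp (measurable_llr pdf0 pdf1 osc)).
  apply: (measurable_fun_cylinders FT (i := inl (inl i))).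
    by rewrite past_data.
  by move=> B mB; exact: sigma_of_preimage.
- move=> i lt_in; apply: (measurable_fun_cylinders FT (i := inl (inr i))).
    by rewrite past_noise.
  by move=> B mB; exact: sigma_of_preimage.
- apply: (measurable_fun_cylinders FT (i := inr tt)); first by rewrite inE.
  by move=> B mB; exact: sigma_of_preimage.
Qed.

Lemma measurable_alive_event n : measurable (alive_event n).
Proof.
apply: measurable_alive => [i _|i _|].
- exact: (measurableT_comp (measurable_llr pdf0 pdf1 osc)).
- exact: measurable_RV.
- exact: measurable_RV.
Qed.

Lemma alive_event_indep n j B : j \notin past n -> F j B ->
  P (alive_event n `&` B) = (P (alive_event n) * P B)%E.
Proof.
move=> jn FB.
apply: (mutually_independent_cylinders _ _ _ XZW (uniq_past n) jn) => //.
- by case=> [[]|] *; exact: sigma_ofT.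
- by case=> [[]|] *; exact: sigma_ofI.
- by case=> [[]|] *; exact: sigma_of_measurable.
- exact: alive_event_past.
Qed.

Lemma expectation_sqr_noise (V : {RV P >-> measurableTypeR R}) (c B : R) :
  has_density (@lebesgue_measure R) V (laplace_pdf beta) -> 0 <= c -> 0 <= B ->
  (\int[P]_w (V w ^+ 2 * c + B)%:E <= (4 * beta ^+ 2 * c + B)%:E)%E.
Proof.
move=> Vf c0 B0.
have mV2 : measurable_fun [set: Omega] (fun w => (V w ^+ 2)%:E).
  by apply/measurable_EFinP; exact: measurable_RV_sqr.
under eq_integral do rewrite EFinD EFinM muleC.
rewrite ge0_integralD//; last 2 first.
- by move=> w _; rewrite mule_ge0// lee_fin ?sqr_ge0.
- exact: emeasurable_funM.
rewrite ge0_integralZl//; last by move=> w _; rewrite lee_fin sqr_ge0.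
have -> : (\int[P]__ B%:E = B%:E)%E.
  rewrite (integral_cst P measurableT) -[RHS]mule1; congr (_ * _)%E.
  exact: probability_setT.
rewrite EFinD leeD2r//.
rewrite EFinM muleC.
rewrite lee_wpmul2r ?lee_fin//.
rewrite (ge0_integral_density (measurable_laplace_pdf beta) Vf
  (g := fun x : measurableTypeR R => ((x : R) ^+ 2)%:E)).
- exact: laplace_second_moment.
- by apply/measurable_EFinP; exact: measurable_funX.
- by move=> x; rewrite lee_fin sqr_ge0.
Qed.

(** The expectation of [sum_alive_le]. As [alive_event n] is independent of the
    [n]-th observation, the expectation of the stopped walk is [I0] times that
    of the stopped crossing time, which is Wald's identity. In the same way the
    squared noises contribute [4 * beta ^ 2] times that expectation. *)
Lemma sum_alive_event_le (N : nat) (a : R) : 0 < a -> 0 < I0 ->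
  I0 * \sum_(n < N) fine (P (alive_event n)) <=
  b + (I0 + Delta + 2 * beta) + a +
  (\sum_(n < N) fine (P (alive_event n))) * (beta ^+ 2 / a).
Proof.
move=> a0 I0_gt0; set M := \sum_(n < N) _.
have [B lB] := llr_bounded osc.
have B0 : 0 <= B by apply: le_trans (normr_ge0 _) (lB [tuple 0 | _ < k]).
have Delta0 : 0 <= Delta := llr_osc_ge0 f0 f1.
have pA n : P (alive_event n) = (fine (P (alive_event n)))%:E.
  by rewrite fineK// fin_num_measure//; exact: measurable_alive_event.
have mA n := measurable_alive_event n.
have ml t : measurable_fun [set: Omega] (l t).
  exact: (measurableT_comp (measurable_llr pdf0 pdf1 osc)).
have m1 n :
    measurable_fun [set: Omega] (fun w => (\1_(alive_event n) w : R)%:E).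
  by apply/measurable_EFinP; exact: measurable_indic.
have mZ (V : {RV P >-> measurableTypeR R}) c D :
    measurable_fun [set: Omega] (fun w => (V w ^+ 2 * c + D)%:E).
  apply/measurable_EFinP/measurable_funD => //; apply: measurable_funM => //.
have c0 : 0 <= (4 * a)^-1 by rewrite invr_ge0 mulr_ge0// ltW.
have cb0 : 0 <= (4 * beta)^-1 by rewrite invr_ge0 mulr_ge0// ltW.
set K := I0 + Delta + b + a + beta.
have K0 : 0 <= K by rewrite !addr_ge0// ltW.
pose lhs w : \bar R :=
  (\sum_(n < N) (\1_(alive_event n) w)%:E * (l n w + B)%:E)%E.
pose rhs w : \bar R := ((W w ^+ 2 * (4 * beta)^-1 + K)%:E +
  \sum_(n < N) (\1_(alive_event n) w)%:E * (Z n w ^+ 2 * (4 * a)^-1 + B)%:E)%E.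
have lB0 n w : 0 <= l n w + B.
  have := lB (X n w); rewrite ler_norml => /andP[+ _].
  by rewrite -/(l n w); lra.
have q0 y c D : 0 <= c -> 0 <= D -> 0 <= y ^+ 2 * c + D :> R.
  by move=> ? ?; rewrite addr_ge0// mulr_ge0// sqr_ge0.
have ind w n : \1_(alive_event n) w = (alive (l^~ w) (Z^~ w) (W w) b n)%:R :> R.
  rewrite indicE; congr (nat_of_bool _)%:R.
  by rewrite /alive_event; apply/idP/idP; rewrite inE.
have le_lr w : (lhs w <= rhs w)%E.
  rewrite /lhs /rhs /=.
  under eq_bigr do rewrite ind -EFinM.
  under [in leRHS]eq_bigr do rewrite ind -EFinM.
  rewrite !sumEFin -EFinD lee_fin.
  under [in leLHS]eq_bigr do rewrite mulrDr.
  under [in leRHS]eq_bigr do rewrite mulrDr.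
  rewrite !big_split/=.
  have L0 : 0 <= I0 + Delta by rewrite addr_ge0// ltW.
  have := sum_alive_le (l := l^~ w) (Z^~ w) (W w) N a0 L0 b_ge0
    (fun t => llr_le_mean pdf0 pdf1 osc (X t w)).
  (* The absolute value of W obeys the same square bound, at a = beta. *)
  have := opp_le_sqr (- `|W w|) beta_gt0.
  rewrite opprK sqrrN real_normK ?num_real//.
  rewrite /K; lra.
have : (\int[P]_w lhs w <= \int[P]_w rhs w)%E.
  apply: ge0_le_integral => //.
  - by move=> w _; apply: sume_ge0 => n _; rewrite mule_ge0// lee_fin.
  - apply: emeasurable_sum => n; apply: emeasurable_funM => //.
    by apply/measurable_EFinP; exact: measurable_funD.
  - apply: emeasurable_funD => //.
    by apply: emeasurable_sum => n; apply: emeasurable_funM => //; exact: mZ.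
rewrite ge0_integral_sum//; last 2 first.
- move=> n; apply: emeasurable_funM => //.
  by apply/measurable_EFinP; exact: measurable_funD.
- by move=> n w _; rewrite mule_ge0// lee_fin.
have -> : (\sum_(n < N) \int[P]_w ((\1_(alive_event n) w)%:E * (l n w + B)%:E)
    = (M * (I0 + B))%:E)%E.
  rewrite /M mulr_suml -sumEFin; apply: eq_bigr => n _.
  rewrite (@ge0_integral_indep _ _ _ _ _ _ (X n) _
    (fun x => (fine (llr f0 f1 x) + B)%:E))//.
  - rewrite (ge0_integral_density _ (Xf n)
      (g := fun x => (fine (llr f0 f1 x) + B)%:E))//.
    + by rewrite integral_f1_llr_shift// EFinM -pA.
    + by case: pdf1.
    + by apply/measurable_EFinP/measurable_funD => //; exact: measurable_llr.
    + move=> x; rewrite lee_fin; have := lB x.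
      by rewrite ler_norml => /andP[+ _]; lra.
  - move=> C XC; apply: (@alive_event_indep _ (inl (inl (n : nat)))) => //.
    by rewrite past_data ltnn.
  - by apply/measurable_EFinP/measurable_funD => //; exact: measurable_llr.
  - move=> x; rewrite lee_fin; have := lB x.
    by rewrite ler_norml => /andP[+ _]; lra.
move=> /le_trans.
have : (\int[P]_w rhs w <= (beta + K + M * (beta ^+ 2 / a + B))%:E)%E.
  rewrite /rhs ge0_integralD//; last 3 first.
  - by move=> w _; rewrite lee_fin q0.
  - by move=> w _; apply: sume_ge0 => n _; rewrite mule_ge0// lee_fin q0.
  - by apply: emeasurable_sum => n; apply: emeasurable_funM => //; exact: mZ.
  rewrite EFinD leeD//.
    apply: le_trans (expectation_sqr_noise Wf cb0 K0) _.
    rewrite lee_fin lerD2r le_eqVlt; apply/orP; left; apply/eqP.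
    by field; exact: lt0r_neq0.
  rewrite ge0_integral_sum//; last 2 first.
  - by move=> n; apply: emeasurable_funM => //; exact: mZ.
  - by move=> n w _; rewrite mule_ge0// lee_fin q0.
  rewrite /M mulr_suml -sumEFin; apply: lee_sum => n _.
  rewrite (@ge0_integral_indep _ _ _ _ _ _ (Z n) _
    (fun x : measurableTypeR R => ((x : R) ^+ 2 * (4 * a)^-1 + B)%:E))//.
  - rewrite EFinM -pA lee_wpmul2l//.
    apply: le_trans (expectation_sqr_noise (Zf n) c0 B0) _.
    rewrite lee_fin lerD2r le_eqVlt; apply/orP; left; apply/eqP.
    by field; exact: lt0r_neq0.
  - move=> C XC; apply: (@alive_event_indep _ (inl (inr (n : nat)))) => //.
    by rewrite past_noise ltnn.
  - by apply/measurable_EFinP/measurable_funD => //; exact: measurable_funM.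
  - by move=> x; rewrite lee_fin q0.
move=> h /(_ _ h); rewrite lee_fin /K !mulrDr; lra.
Qed.

End expected_passage.

(** * Quadratic inequality and conclusion *)

Section quadratic_inequality.
Context (R : realType).

(** With [r = sqrt m] the hypothesis is quadratic in [r]; solving it gives
    [I * r <= 2 * beta + sqrt (I * b) + sqrt (I * K)], which is put back into
    its right-hand side. *)
Lemma le_of_sqrt_bound (I m b K beta : R) :
  0 < I -> 0 < beta -> 0 <= b -> 0 <= K -> 0 <= m ->
  I * m <= b + K + 2 * beta * Num.sqrt m ->
  m <= b / I + 2 * beta / (I * Num.sqrt I) * Num.sqrt b +
    (K / I + 4 * beta ^+ 2 / I ^+ 2
     + 2 * beta * Num.sqrt I * Num.sqrt K / I ^+ 2).
Proof.
move=> I0 beta0 b0 K0 m0.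
have sI0 : 0 < Num.sqrt I by rewrite sqrtr_gt0.
have sb0 := sqrtr_ge0 b; have sK0 := sqrtr_ge0 K; have sm0 := sqrtr_ge0 m.
have EI := sqr_sqrtr (ltW I0); have Eb := sqr_sqrtr b0.
have EK := sqr_sqrtr K0; have Em := sqr_sqrtr m0.
move: sI0 sb0 sK0 sm0 EI Eb EK Em.
set s := Num.sqrt I; set p := Num.sqrt b.
set q := Num.sqrt K; set r := Num.sqrt m.
move=> s0 p0 q0 r0 EI Eb EK Em h.
have hr : I * r <= 2 * beta + s * p + s * q.
  rewrite leNgt; apply/negP => lt_r.
  have sp0 : 0 <= s * p by rewrite mulr_ge0// ltW.
  have sq0 : 0 <= s * q by rewrite mulr_ge0// ltW.
  have : (2 * beta + s * p + s * q) * (s * p + s * q) <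
      I * r * (I * r - 2 * beta).
    by apply: ltr_pM; lra.
  have : I * r * (I * r - 2 * beta) <= I * (b + K).
    have -> : I * r * (I * r - 2 * beta) = I * (I * r ^+ 2 - 2 * beta * r).
      by ring.
    by rewrite ler_wpM2l ?(ltW I0)// Em; lra.
  have -> : (2 * beta + s * p + s * q) * (s * p + s * q) =
      2 * beta * (s * p + s * q) + s ^+ 2 * p ^+ 2 + s ^+ 2 * q ^+ 2
      + 2 * (s * p * (s * q)) by ring.
  rewrite EI Eb EK.
  have : 0 <= 2 * beta * (s * p + s * q) by rewrite !mulr_ge0 ?addr_ge0// ltW.
  have : 0 <= s * p * (s * q) by rewrite mulr_ge0.
  lra.
have h2 : I * m <= b + K + 2 * beta * ((2 * beta + s * p + s * q) / I).
  apply: (le_trans h); rewrite lerD2l ler_wpM2l ?mulr_ge0 ?(ltW beta0)//.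
  by rewrite ler_pdivlMr// mulrC.
have -> : b / I + 2 * beta / (I * s) * p +
    (K / I + 4 * beta ^+ 2 / I ^+ 2 + 2 * beta * s * q / I ^+ 2) =
  (b + K + 2 * beta * ((2 * beta + s * p + s * q) / I)) / I.
  rewrite -EI; field; exact: lt0r_neq0.
by rewrite ler_pdivlMr// mulrC.
Qed.

End quadratic_inequality.

Theorem theorem3 (R : realType) :
  exists C : R -> R -> R -> R,
  forall (k : nat) (f0 f1 : k.-tuple (measurableTypeR R) -> R),
    is_pdf f0 -> is_pdf f1 ->
    ~ {ae lebesgue_tuple R k, forall x, f0 x = f1 x} ->
    (llr_osc f0 f1 < +oo)%E ->
  forall eps : R, 0 < eps ->
  let Delta := fine (llr_osc f0 f1) in
  let I0 := fine (kl_divergence f1 f0) in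
  forall (d : measure_display) (Omega : measurableType d)
    (P : probability Omega R)
    (X : nat -> {RV P >-> k.-tuple (measurableTypeR R)})
    (Z : nat -> {RV P >-> measurableTypeR R})
    (W : {RV P >-> measurableTypeR R}),
    (forall t, has_density (lebesgue_tuple R k) (X t) f1) ->
    (forall t, has_density (@lebesgue_measure R) (Z t)
                 (laplace_pdf (2 * Delta / eps))) ->
    has_density (@lebesgue_measure R) W (laplace_pdf (2 * Delta / eps)) ->
    mutually_independent P (data_noise_sigma X Z W) ->
  forall b : R, 0 < b ->
  (\int[P]_w dp_cusum_time (fun t => llr f0 f1 (X t w))
               (fun t => Z t w) (W w) b
   <= (b / I0 + 4 * Delta / (I0 `^ (3 / 2) * eps) * Num.sqrt b
       + C Delta eps I0)%:E)%E.
Proof.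
exists (fun Delta eps I0 => let beta := 2 * Delta / eps in
  let K := I0 + Delta + 2 * beta in
  K / I0 + 4 * beta ^+ 2 / I0 ^+ 2
  + 2 * beta * Num.sqrt I0 * Num.sqrt K / I0 ^+ 2).
move=> k f0 f1 pdf0 pdf1 f01 osc eps eps0 Delta I0.
move=> d Omega P X Z W Xf Zf Wf XZW b b0.
have I0_gt0 : 0 < I0 by exact: kl_divergence_gt0.
have Delta0 : 0 <= Delta := llr_osc_ge0 f0 f1.
move: Zf Wf; set beta := 2 * Delta / eps => Zf Wf.
have beta0 : 0 < beta.
  by apply: (laplace_density_gt0 Wf); rewrite divr_ge0 ?mulr_ge0// ltW.
rewrite /=; set K := I0 + Delta + 2 * beta.
have K0 : 0 <= K by rewrite /K; lra.
pose A := alive_event f0 f1 X Z W b.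
have mA n : measurable (A n) by exact: measurable_alive_event.
have -> : 4 * Delta / (I0 `^ (3 / 2) * eps) = 2 * beta / (I0 * Num.sqrt I0).
  have -> : 3 / 2 = 1 + 2^-1 :> R by lra.
  rewrite powRD ?(gt_eqF I0_gt0) ?implybT// powRr1 ?ltW// powR12_sqrt ?ltW//.
  rewrite /beta; field.
  by rewrite !gt_eqF// sqrtr_gt0.
set bound := (X in (_ <= X%:E)%E).
have bnd N : (\sum_(0 <= n < N) P (A n) <= bound%:E)%E.
  have -> : (\sum_(0 <= n < N) P (A n) = (\sum_(n < N) fine (P (A n)))%:E)%E.
    rewrite big_mkord -sumEFin; apply: eq_bigr => n _.
    by rewrite fineK// fin_num_measure.
  rewrite lee_fin.
  set m := \sum_(n < N) _.
  have m0 : 0 <= m by apply: sumr_ge0 => n _; rewrite fine_ge0.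
  apply: le_of_sqrt_bound => //; first exact: ltW.
  move: (m0); rewrite le_eqVlt => /predU1P[<-|m_gt0].
    by rewrite mulr0 sqrtr0 mulr0 addr0 addr_ge0// ltW.
  (* This value of a balances the terms a and m * beta ^ 2 / a. *)
  have a0 : 0 < beta * Num.sqrt m by rewrite mulr_gt0// sqrtr_gt0.
  have := sum_alive_event_le
    pdf0 pdf1 osc beta0 (ltW b0) Xf Zf Wf XZW N a0 I0_gt0.
  rewrite -/m -/K.
  have -> : m * (beta ^+ 2 / (beta * Num.sqrt m)) = beta * Num.sqrt m.
    rewrite -{1}(sqr_sqrtr m0); field.
    by rewrite !gt_eqF// sqrtr_gt0.
  by move=> h; apply: (le_trans h); lra.
apply: (@le_trans _ _ (\int[P]_w (\sum_(0 <= n <oo) (\1_(A n) w)%:E))%E).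
  have le0 : forall w, (0 <= dp_cusum_time (fun t => llr f0 f1 (X t w))
      (fun t => Z t w) (W w) b)%E.
    by move=> w; apply: le_ereal_inf_tmp => _ [t _ <-]; rewrite lee_fin.
  apply: ge0_le_integralT => // w.
  have -> : (fun t => llr f0 f1 (X t w)) =
      (fun t => (fine (llr f0 f1 (X t w)))%:E).
    by apply/funext => t; exact: llr_EFin.
  apply: (le_trans (dp_cusum_time_le _ _ _ _)).
  apply: lee_nneseries => [n _ _|n _]; first by rewrite lee_fin.
  rewrite lee_fin indicE ler_nat.
  by case: (boolP (alive _ _ _ _ _)) => // an; rewrite mem_set.
rewrite integral_nneseries//; last first.
  by move=> n; apply/measurable_EFinP; exact: measurable_indic.
apply: lime_le; first by apply: is_cvg_nneseries => n _ _; apply: integral_ge0.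
apply: nearW => N.
rewrite (eq_bigr (fun n => P (A n))); first exact: bnd.
by move=> n _; rewrite integral_indic// setIT.
Qed.
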